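(* Let $\Lambda_0\subset\mathbb{R}^n$ be an $n$-dimensional lattice of density $\beta=e^{n\delta}$, used over an additive circularly-symmetric noise (ACSN) channel whose noise norm $\|z\|$ has density $f_{\|z\|}$. For $r>0$ define $$\alpha(r)=\inf_{\alpha'\in\mathcal{A}_{2r}}\ \sup_{0<x\le 2e^{\delta}r}\alpha'(x).$$ Then the error probability of the maximum-likelihood (nearest-lattice-point) decoder satisfies, for every $r>0$, $$P_e(\Lambda_0)\le \alpha(r)\,\beta V_n\int_0^{r}f_{\|z\|}(\rho)\rho^n\,d\rho+\int_r^\infty f_{\|z\|}(\rho)\,d\rho,$$ and hence $P_e(\Lambda_0)$ is at most the minimum over $r$ of the right-hand side.
   Context: An ACSN channel: the receiver observes $y=\lambda+z$, where $\lambda$ is the transmitted lattice point and $z\in\mathbb{R}^n$ is noise whose distribution is isotropic (invariant under orthogonal maps) with density a non-increasing function of $\|z\|$; $f_{\|z\|}$ is the density of $\|z\|$. The ML decoder errs when $z$ is not in the Voronoi cell $\{y:\|y\|<\|y-\lambda\|\ \forall\lambda\in\Lambda_0\setminus\{0\}\}$ of $0$; $P_e(\Lambda_0)$ is this probability. $V_n$ is the volume of the unit $n$-ball, $\beta=1/\det\Lambda_0$, $\delta=\frac1n\ln\beta$. The distance series $0<\lambda_1<\lambda_2<\cdots$ lists the distinct norms of nonzero lattice vectors, $\mathcal{N}_j=\#\{\lambda\in\Lambda_0:\|\lambda\|=\lambda_j\}$, and $\widetilde\lambda_j=e^{\delta}\lambda_j$. For $L>0$, $\mathcal{A}_L$ is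 the set of functions $\alpha'(x)=N'(x)/(nV_nx^{n-1})$ ($x>0$), where $N'\ge0$ is a locally integrable function on $(0,\infty)$ with $\sum_{j:\widetilde\lambda_j\le t}\mathcal{N}_j\le\int_0^tN'(x)\,dx$ for all $t\in(0,e^{\delta}L]$. (In the paper, $\alpha(r)=\max_{x\le 2e^{\delta}r}\alpha^{\mathrm{opt}}(x)$ with $\alpha^{\mathrm{opt}}$ a minimizer of this min–max problem.) *)

(* Defs.v *)
From HB Require Import structures.
From mathcomp Require Import all_boot all_order all_algebra.
From mathcomp Require Import all_classical all_reals all_analysis.
Set Implicit Arguments. Unset Strict Implicit. Unset Printing Implicit Defensive.
Import Order.TTheory GRing.Theory Num.Theory.
Import numFieldNormedType.Exports.
Local Open Scope classical_set_scope.
Local Open Scope ring_scope.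

Section ACSN.
Context {R : realType}.

Fixpoint unit_ball_vol (n : nat) : R :=
  match n with
  | 0 => 1
  | 1 => 2
  | m.+2 => (2 * pi / (m.+2)%:R) * unit_ball_vol m
  end.

Definition enorm {n : nat} (x : 'rV[R]_n) : R :=
  Num.sqrt (\sum_(i < n) x ord0 i ^+ 2).

Definition lattice {n : nat} (B : 'M[R]_n) : set 'rV[R]_n :=
  [set v *m B | v in [set v : 'rV[R]_n | forall i, v ord0 i \is a Num.int]].

Definition voronoi0 {n : nat} (B : 'M[R]_n) : set 'rV[R]_n :=
  [set y | forall l, lattice B l -> l != 0 -> enorm y < enorm (y - l)].

Definition lat_beta {n : nat} (B : 'M[R]_n) : R := (`|\det B|)^-1.
Definition lat_delta {n : nat} (B : 'M[R]_n) : R := ln (lat_beta B) / n%:R.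
Definition edelta {n : nat} (B : 'M[R]_n) : R := expR (lat_delta B).

(* sum_{j : ~lambda_j <= t} N_j = number of nonzero lattice points
   with e^delta * ||lambda|| <= t. *)
Definition count_upto {n : nat} (B : 'M[R]_n) (t : R) : \bar R :=
  \esum_(l in [set l | lattice B l /\ l != 0 /\ edelta B * enorm l <= t]) 1%E.

Definition admissible_Nprime {n : nat} (B : 'M[R]_n) (L : R) (N' : R -> R) : Prop :=
  [/\ measurable_fun (`]0, +oo[ : set R) N',
      (forall x, 0 < x -> 0 <= N' x),
      (forall a b, 0 < a ->
          (@lebesgue_measure R).-integrable `[a, b] (EFin \o N')) &
      (forall t, 0 < t -> t <= edelta B * L ->
          (count_upto B t <= \int[lebesgue_measure]_(x in `]0%R, t]) (N' x)%:E)%E)].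

Definition alpha_prime (n : nat) (N' : R -> R) (x : R) : R :=
  N' x / (n%:R * unit_ball_vol n * x ^+ n.-1).

Definition alpha_r {n : nat} (B : 'M[R]_n) (r : R) : \bar R :=
  ereal_inf [set ereal_sup [set (alpha_prime n N' x)%:E | x in `]0, 2 * edelta B * r]]
            | N' in admissible_Nprime B (2 * r)].

Definition pe_bound {n : nat} (B : 'M[R]_n) (f : R -> R) (r : R) : \bar R :=
  (alpha_r B r * ((lat_beta B * unit_ball_vol n)%:E *
      \int[lebesgue_measure]_(x in `[0%R, r]) (f x * x ^+ n)%:E)
   + \int[lebesgue_measure]_(x in (`[r, +oo[ : set R)) (f x)%:E)%E.

End ACSN.

(* Main.v *)
Require Import Defs.
From HB Require Import structures.
From mathcomp Require Import all_boot all_order all_algebra.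
From mathcomp Require Import all_classical all_reals all_analysis.
From mathcomp Require Import measurable_realfun.
From mathcomp Require Import ring.
Import Order.TTheory GRing.Theory Num.Theory.
Import numFieldNormedType.Exports.
Local Open Scope classical_set_scope.
Local Open Scope ring_scope.

(* The decoder errs with [|z| < r] only if [z] lies in one of the half-spaces
   [|l|^2 <= 2 <z, l>], [l] a nonzero lattice vector. By isotropy such an event
   has the same probability as [|l| <= 2 z_0], so summing over [l] and exchanging
   sum and expectation bounds the error by the expected number of nonzero lattice
   vectors of norm at most [2 z_0]. That number is at most
   [sup alpha' * V_n * beta * (2 z_0)^n], and it remains to see that
   [E[(2 z_0)_+^n; |z| < r] <= E[|z|^n; |z| < r]]. The same exchange with Lebesgue
   measure on [R^n] in place of the lattice gives this: it compares the ball
   [{x : |x - z| <= |z|}], of volume proportional to [|z|^n], with the centred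
   ball of radius [2 z_0]. Only the behaviour of Lebesgue measure under
   translations and homotheties is needed, not polar coordinates. *)

(** * Lebesgue measure on the line and on [R^n] *)

Lemma exists_pushforward_measure (d d' : measure_display)
    (T : measurableType d) (T' : measurableType d') (R : realType)
    (m : {measure set T -> \bar R}) (f : T -> T') :
  measurable_fun setT f ->
  exists m' : {measure set T' -> \bar R}, forall A, m' A = m (f @^-1` A).
Proof. by move=> mf; unshelve (exists (pushforward m f)). Qed.

(** Turns sigma-finiteness from a proposition into structure carried by the measure, as Tonelli's
    theorem requires of its arguments. *)
Lemma exists_sigma_finite_measure (d : measure_display) (T : measurableType d)
    (R : realType) (m : {measure set T -> \bar R}) :
  sigma_finite setT m ->
  exists m' : {sigma_finite_measure set T -> \bar R}, m' = m :> (set T -> \bar R).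
Proof.
move=> sf.
pose H1 := isSFinite.Build _ _ _ (m : set T -> \bar R) (sfinite_measure_sigma_finite sf).
pose H2 := isSigmaFinite.Build _ _ _ (m : set T -> \bar R) sf.
pose m' : {sigma_finite_measure set T -> \bar R} := HB.pack (Measure.sort m) H1 H2.
by exists m'.
Qed.

(** The pushforward under [x |-> s * x + c], multiplied by [s], gives each []a, b]] its length, so
    uniqueness of Lebesgue measure identifies it. *)
Lemma lebesgue_measure_affine (R : realType) (s c : R) (A : set R) :
  0 < s -> measurable A ->
  lebesgue_measure [set x | A (s * x + c)] = (s^-1%:E * lebesgue_measure A)%E.
Proof.
move=> s0 mA.
pose phi : R -> measurableTypeR R := fun x => s * x + c.
have mphi : measurable_fun [set: measurableTypeR R] phi.
  by apply: measurable_funD => //; exact: measurable_funM.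
have [pf pfE] := exists_pushforward_measure _ _ _ _ _ (@lebesgue_measure R) phi mphi.
pose m' : {measure set (measurableTypeR R) -> \bar R} := mscale (NngNum (ltW s0)) pf.
have -> : lebesgue_measure A = m' A.
  apply: (@lebesgue_measure_unique _ m') => // _ [[a b] _ <-].
  rewrite /m' /= /mscale /= pfE.
  have -> : phi @^-1` `]a, b] = `](a - c) / s, (b - c) / s]%classic.
    apply/seteqP; split => x /=; rewrite !in_itv /= /phi.
      by rewrite ltr_pdivrMr // ler_pdivlMr // ltrBlDr lerBrDr (mulrC x).
    by rewrite ltr_pdivrMr // ler_pdivlMr // ltrBlDr lerBrDr (mulrC x).
  rewrite lebesgue_measure_itv [X in (_ * X)%E]lebesgue_measure_itv /= !lte_fin.
  rewrite ltr_pM2r ?invr_gt0 // ltrD2r.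
  case: ifP => _; last by rewrite mule0.
  rewrite -!EFinB -EFinM; congr EFin.
  by rewrite -mulrBl mulrCA mulfV ?gt_eqF // mulr1 opprB addrA addrNK.
by rewrite /m' /= /mscale /= pfE muleA -EFinM mulVf ?gt_eqF // mul1e.
Qed.

Lemma ge0_integral_affine (R : realType) (s c : R) (g : R -> \bar R) :
  0 < s -> measurable_fun setT g -> (forall x, 0 <= g x)%E ->
  (\int[lebesgue_measure]_x g (s * x + c)%R =
     s^-1%:E * \int[lebesgue_measure]_x g x)%E.
Proof.
move=> s0 mg g0.
pose phi : R -> measurableTypeR R := fun x => s * x + c.
have mphi : measurable_fun [set: measurableTypeR R] phi.
  by apply: measurable_funD => //; exact: measurable_funM.
have s0' : 0 <= s^-1 by rewrite invr_ge0 ltW.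
have := ge0_integral_pushforward mphi (@lebesgue_measure R) measurableT mg (fun y _ => g0 y).
rewrite preimage_setT => <-.
rewrite (eq_measure_integral (mscale (NngNum s0') (@lebesgue_measure R))).
  by rewrite ge0_integral_mscale.
by move=> A mA _; exact: lebesgue_measure_affine.
Qed.

(** Tuples stand for [R^n] wherever a product measure is needed, since their sigma-algebra is
    generated by the coordinates; [tuple_row] leads back to row vectors. *)
Definition tuple_affine {R : realType} {n : nat} (s : R) (c x : n.-tuple R) :
  n.-tuple R := [tuple s * tnth x i + tnth c i | i < n].

Definition tuple_cube {R : realType} (n : nat) (a b : R) : set (n.-tuple R) :=
  [set x | forall i, a <= tnth x i <= b].

Lemma measurable_tuple_cube (R : realType) (n : nat) (a b : R) :
  measurable (tuple_cube n a b).
Proof.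
rewrite (_ : tuple_cube _ _ _ =
    \bigcap_(i in [set: 'I_n]) ((fun x => tnth x i) @^-1` `[a, b]%classic)).
  apply: fin_bigcap_measurable => // i _; rewrite -[X in measurable X]setTI.
  exact: measurable_tnth.
apply/seteqP; split=> [x xab i _|x xab i]; rewrite /= ?in_itv /=; first exact: xab.
by have := xab i I; rewrite /= in_itv.
Qed.

(** Built by induction: the product of the line with dimension [n] is pushed forward along consing a
    coordinate. Scaling and cube volumes are all that is recorded; together they give balls a volume
    proportional to a power of the radius. *)
Lemma tuple_lebesgue_measure (R : realType) (n : nat) :
  exists mu : {sigma_finite_measure set (n.-tuple R) -> \bar R},
    (forall s c A, 0 < s -> measurable A ->
       mu (tuple_affine s c @^-1` A) = ((s^-1 ^+ n)%:E * mu A)%E) /\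
    (forall a b, a <= b -> mu (tuple_cube n a b) = ((b - a) ^+ n)%:E).
Proof.
elim: n => [|n [mu [mu_aff mu_cube]]].
  exists (dirac [tuple]); split => [s c A s0 mA|a b ab].
    rewrite /= expr0 mul1e !diracE; congr ((_ : bool)%:R%:E).
    have e : tuple_affine s c [tuple] = [tuple] by rewrite tuple0.
    by apply/idP/idP => /set_mem At; apply/mem_set; move: At; rewrite /preimage /= e.
  by rewrite /= expr0 diracE mem_set // => -[].
pose phi (p : R * n.-tuple R) : n.+1.-tuple R := [the n.+1.-tuple R of p.1 :: p.2].
have mphi : measurable_fun setT phi.
  by apply: measurable_cons; [exact: measurable_fst|exact: measurable_snd].
have [nu nuE] := exists_pushforward_measure _ _ _ _ _ (@lebesgue_measure R \x mu)%E phi mphi.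
have nu_cube a b : a <= b -> nu (tuple_cube n.+1 a b) = ((b - a) ^+ n.+1)%:E.
  move=> ab; rewrite nuE.
  rewrite (_ : phi @^-1` _ = `[a, b]%classic `*` tuple_cube n a b).
    rewrite [LHS]product_measure1E //; last exact: measurable_tuple_cube.
    rewrite [X in (X * _)%E]lebesgue_measure_itv /= lte_fin mu_cube // exprS.
    case: ltP => [_|ba]; first by rewrite -EFinB -EFinM.
    by rewrite (@le_anti _ _ a b) ?ab ?ba // subrr !mul0r mul0e.
  apply/seteqP; split=> [[x t] xab|[x t] /= [xab tab] i]; rewrite /= ?in_itv /=.
    split; first exact: (xab ord0).
    by move=> i; have := xab (lift ord0 i); rewrite tnthS.
  case: (unliftP ord0 i) => [j ->|->].
    by rewrite tnthS; exact: tab.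
  by move: xab; rewrite in_itv.
have nu_sf : sigma_finite setT nu.
  exists (fun k => tuple_cube n.+1 (- k%:R) k%:R).
    apply/esym; rewrite -subTset => x _.
    have [k kx] : exists k : nat, forall i, `|tnth x i| <= k%:R.
      exists (\max_i Num.bound `|tnth x i|)%N => i.
      apply: (le_trans (ltW (archi_boundP (normr_ge0 _)))).
      by rewrite ler_nat; exact: (leq_bigmax i).
    by exists k => // i; rewrite -ler_norml.
  move=> k; split; first exact: measurable_tuple_cube.
  by rewrite nu_cube ?ltry // (@le_trans _ _ 0) ?oppr_le0.
have [nu' nu'E] := exists_sigma_finite_measure _ _ _ nu nu_sf.
exists nu'; rewrite nu'E; split => // s c A s0 mA; rewrite !nuE /= /product_measure1 /=.
have mphiA : measurable (phi @^-1` A) by rewrite -[X in measurable X]setTI; exact: mphi.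
pose g x := mu (xsection (phi @^-1` A) x).
have mg : measurable_fun setT g by exact: measurable_fun_xsection.
(* The head coordinate yields one factor [s^-1] by the one-dimensional change of variables; the
   induction hypothesis, applied to each section, yields the others. *)
rewrite exprSr EFinM -muleA -(ge0_integral_affine _ _ (tnth c ord0) g) //.
rewrite -ge0_integralZl //; first last.
- by rewrite lee_fin exprn_ge0 // invr_ge0 ltW.
- by apply: measurableT_comp => //=; apply: measurable_funD => //; exact: measurable_funM.
apply: eq_integral => x _; rewrite -(mu_aff _ [tuple of behead c]) //; last first.
  exact: measurable_xsection.
congr (mu _).
have e t : tuple_affine s c (phi (x, t)) =
    phi (s * x + tnth c ord0, tuple_affine s [tuple of behead c] t).
  apply: eq_from_tnth => i; case: (unliftP ord0 i) => [j ->|->].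
    rewrite tnth_mktuple !tnthS tnth_mktuple tnth_behead; congr (_ + tnth _ _).
    by apply: val_inj; rewrite /= inordK ?ltnS.
  by rewrite tnth_mktuple.
apply/seteqP; split => t; by rewrite /xsection /= !inE /= e.
Qed.

(** * Euclidean geometry of row vectors: half-spaces and reflections *)

Definition dotrv {R : realType} {n : nat} (x y : 'rV[R]_n) : R :=
  \sum_(i < n) x ord0 i * y ord0 i.

Lemma dotrvE (R : realType) (n : nat) (x y : 'rV[R]_n) : x *m y^T = (dotrv x y)%:M.
Proof.
rewrite [LHS]mx11_scalar mxE; congr (_%:M).
by apply: eq_bigr => i _; rewrite mxE.
Qed.

Lemma dotrv_mx (R : realType) (n : nat) (x y : 'rV[R]_n) :
  dotrv x y = (x *m y^T) ord0 ord0.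
Proof. by rewrite dotrvE mxE eqxx. Qed.

Lemma sqr_enorm (R : realType) (n : nat) (x : 'rV[R]_n) : enorm x ^+ 2 = dotrv x x.
Proof.
rewrite sqr_sqrtr; last by apply: sumr_ge0 => i _; exact: sqr_ge0.
by apply: eq_bigr => i _; rewrite expr2.
Qed.

Lemma enorm_ge0 (R : realType) (n : nat) (x : 'rV[R]_n) : 0 <= enorm x.
Proof. exact: sqrtr_ge0. Qed.

Lemma enorm_gt0 (R : realType) (n : nat) (x : 'rV[R]_n) : x != 0 -> 0 < enorm x.
Proof.
move=> x0; rewrite lt_def enorm_ge0 andbT; apply: contra x0 => /eqP xE0.
apply/eqP/rowP => i; rewrite mxE; apply/eqP; rewrite -sqrf_eq0.
have : \sum_(j < n) x ord0 j ^+ 2 == 0.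
  have -> : \sum_(j < n) x ord0 j ^+ 2 = dotrv x x.
    by apply: eq_bigr => j _; rewrite expr2.
  by rewrite -sqr_enorm xE0 expr0n.
by rewrite psumr_eq0 => [/allP/(_ i)|j _]; [apply; rewrite mem_index_enum|exact: sqr_ge0].
Qed.

Lemma normr_le_enorm (R : realType) (n : nat) (x : 'rV[R]_n) (i : 'I_n) :
  `|x ord0 i| <= enorm x.
Proof.
rewrite -sqrtr_sqr; apply: ler_wsqrtr; rewrite (bigD1 i) //= lerDl.
by apply: sumr_ge0 => j _; exact: sqr_ge0.
Qed.

(** Expanding [|x - l|^2] cancels [|x|^2], so being at least as close to [l] as to the origin is a
    half-space condition on [x]. *)
Lemma enormB_le (R : realType) (n : nat) (x l : 'rV[R]_n) :
  (enorm (x - l) <= enorm x) = (enorm l ^+ 2 <= 2 * dotrv x l).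
Proof.
rewrite -(@ler_pXn2r _ 2) ?nnegrE ?enorm_ge0 // !sqr_enorm.
have -> : dotrv (x - l) (x - l) = dotrv x x + (dotrv l l - 2 * dotrv x l).
  rewrite /dotrv mulr_sumr -sumrB -big_split /=; apply: eq_bigr => i _.
  by rewrite !mxE -!expr2 sqrrB addrAC -addrA -mulr_natl.
by rewrite gerDl subr_le0.
Qed.

(* The Householder reflection along [l - ||l|| e_0]. *)
Lemma orthogonal_to_first_axis (R : realType) (n : nat) (l : 'rV[R]_n.+1) :
  exists2 Q : 'M[R]_n.+1, Q *m Q^T = 1%:M &
    forall x, enorm (x *m Q) = enorm x /\
              dotrv (x *m Q) l = enorm l * x ord0 ord0.
Proof.
suff [Q QQ Ql] : exists2 Q : 'M[R]_n.+1, Q *m Q^T = 1%:M &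
    Q *m l^T = (enorm l *: delta_mx ord0 ord0)^T.
  exists Q => // x; split.
    apply/eqP; rewrite -(@eqrXn2 _ 2) ?enorm_ge0 // !sqr_enorm.
    by rewrite !dotrv_mx trmx_mul mulmxA -(mulmxA x) QQ mulmx1.
  rewrite dotrv_mx -mulmxA Ql linearZ /= trmx_delta -scalemxAr.
  rewrite !mxE; congr (_ * _); rewrite (bigD1 ord0) //= big1 ?addr0.
    by rewrite !mxE !eqxx mulr1.
  by move=> k k0; rewrite !mxE (negPf k0) mulr0.
set v := enorm l *: delta_mx ord0 ord0.
pose u := l - v.
have [u0|u0] := eqVneq u 0.
  exists 1%:M; first by rewrite trmx1 mulmx1.
  by rewrite mul1mx; congr (_^T); apply/eqP; rewrite -subr_eq0 -/u u0.
pose c := 2 / dotrv u u.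
have uu0 : dotrv u u != 0 by rewrite -sqr_enorm sqrf_eq0 gt_eqF // enorm_gt0.
have cuu : c * dotrv u u = 2 by rewrite mulfVK.
have vv : dotrv v v = dotrv l l.
  rewrite -[RHS]sqr_enorm /dotrv /v (bigD1 ord0) //= big1 ?addr0.
    by rewrite !mxE !eqxx mulr1 expr2.
  by move=> k k0; rewrite !mxE (negPf k0) mulr0 mulr0.
(* Since [v] and [l] have the same norm, [|u|^2 = 2 <u, l>]. Hence the reflection subtracts exactly
   [u] from [l] and lands on [v]. *)
have cul : c * dotrv u l = 1.
  have e : dotrv u u = 2 * dotrv u l.
    have -> : dotrv u u = 2 * dotrv u l + (dotrv v v - dotrv l l).
      rewrite /dotrv mulr_sumr -sumrB -big_split /=; apply: eq_bigr => i _.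
      by rewrite /u !mxE; ring.
    by rewrite vv subrr addr0.
  by apply: (@mulfI _ 2) => //; rewrite mulrCA -e mulr1.
exists (1%:M - c *: (u^T *m u)).
  rewrite [X in _ *m X = _](_ : _ = 1%:M - c *: (u^T *m u)); last first.
    by rewrite linearB /= trmx1 linearZ /= trmx_mul trmxK.
  rewrite mulmxBr mulmx1 mulmxBl mul1mx -scalemxAr -scalemxAl.
  rewrite -mulmxA (mulmxA u) dotrvE mul_scalar_mx -scalemxAr !scalerA -mulrA cuu.
  rewrite -scalerBl -addrA -opprD -scalerDl.
  by rewrite (_ : c + (c - c * 2) = 0) ?scale0r ?subr0 //; ring.
rewrite mulmxBl mul1mx -scalemxAl -mulmxA dotrvE mul_mx_scalar scalerA cul scale1r.
by rewrite /u linearB /= opprB addrC subrK.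
Qed.

(** * Isotropy and half-space events *)

Definition random_vector {R : realType} {n : nat} {d : measure_display}
    {T : measurableType d} (z : T -> 'rV[R]_n) : Prop :=
  forall A : set 'rV[R]_n, <<s @open 'rV[R]_n >> A -> measurable (z @^-1` A).

Definition isotropic {R : realType} {n : nat} {d : measure_display}
    {T : measurableType d} (P : probability T R) (z : T -> 'rV[R]_n) : Prop :=
  forall Q : 'M[R]_n, Q *m Q^T = 1%:M ->
    forall A : set 'rV[R]_n, <<s @open 'rV[R]_n >> A ->
      P (z @^-1` A) = P ((fun t => z t *m Q) @^-1` A).

Lemma random_vector_coord (R : realType) (n : nat) (d : measure_display)
    (T : measurableType d) (z : T -> 'rV[R]_n) (i : 'I_n) :
  random_vector z -> measurable_fun setT (fun t => z t ord0 i).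
Proof.
move=> mz; apply: (measurability _ (RGenOpens.measurableE R)) => _ [_ [a [b ->]] <-].
rewrite setTI; apply: (mz ((fun v : 'rV[R]_n => v ord0 i) @^-1` `]a, b[%classic)).
apply: sub_sigma_algebra; apply: open_comp; last exact: interval_open.
by move=> v _; exact: coord_continuous.
Qed.

Lemma measurable_enorm (R : realType) (n : nat) (d : measure_display)
    (T : measurableType d) (x : T -> 'rV[R]_n) :
  (forall i, measurable_fun setT (fun t => x t ord0 i)) ->
  measurable_fun setT (fun t => enorm (x t)).
Proof.
move=> mx; rewrite /enorm.
apply: (@measurableT_comp _ _ _ _ _ _ (fun y : R => Num.sqrt y)).
  by apply: nondecreasing_measurable => // a b; exact: ler_wsqrtr.
by apply: measurable_sum => i; exact: measurable_funX.
Qed.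

Lemma measurable_dotrv (R : realType) (n : nat) (d : measure_display)
    (T : measurableType d) (x y : T -> 'rV[R]_n) :
  (forall i, measurable_fun setT (fun t => x t ord0 i)) ->
  (forall i, measurable_fun setT (fun t => y t ord0 i)) ->
  measurable_fun setT (fun t => dotrv (x t) (y t)).
Proof. by move=> mx my; apply: measurable_sum => i; exact: measurable_funM. Qed.

Lemma measurable_ltr_set (R : realType) (d : measure_display)
    (T : measurableType d) (f g : T -> R) :
  measurable_fun setT f -> measurable_fun setT g ->
  measurable [set t | f t < g t].
Proof.
move=> mf mg; rewrite -[X in measurable X]setTI.
exact: (measurable_fun_ltr mf mg measurableT (Y := [set true])).
Qed.

Lemma measurable_ler_set (R : realType) (d : measure_display)
    (T : measurableType d) (f g : T -> R) :
  measurable_fun setT f -> measurable_fun setT g ->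
  measurable [set t | f t <= g t].
Proof.
move=> mf mg; rewrite -[X in measurable X]setTI.
exact: (measurable_fun_ler mf mg measurableT (Y := [set true])).
Qed.

(** Isotropy is applied to the reflection [Q] adapted to [l]: it preserves the norm and turns
    [<z, l>] into [|l| z_0]. *)
Lemma isotropic_halfspace (R : realType) (n : nat) (d : measure_display)
    (T : measurableType d) (P : probability T R) (z : T -> 'rV[R]_n.+1) (r : R)
    (l : 'rV[R]_n.+1) : isotropic P z ->
  P [set t | enorm (z t) < r /\ enorm l ^+ 2 <= 2 * dotrv (z t) l] =
  P [set t | enorm (z t) < r /\ enorm l ^+ 2 <= 2 * (enorm l * z t ord0 ord0)].
Proof.
move=> iso; have [Q QQ Ql] := orthogonal_to_first_axis _ _ l.
pose A := [set v : 'rV[R]_n.+1 | enorm v < r /\ enorm l ^+ 2 <= 2 * dotrv v l].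
have BA : <<s @open 'rV[R]_n.+1 >> A.
  (* On the row vectors with their Borel sigma-algebra the identity is itself a random vector, so
     the measurability lemmas apply to the set [A]. *)
  pose W := g_sigma_algebraType (@open 'rV[R]_n.+1).
  have mW i : measurable_fun setT (fun v : W => (v : 'rV[R]_n.+1) ord0 i).
    exact: (@random_vector_coord _ _ _ W idfun).
  apply: (@measurableI _ W).
    exact: (measurable_ltr_set _ _ W _ (cst r) (measurable_enorm _ _ _ _ _ mW)).
  apply: (measurable_ler_set _ _ W (cst (enorm l ^+ 2))) => //.
  by apply: measurable_funM => //; apply: measurable_dotrv.
rewrite [LHS](iso Q QQ A BA); congr (P _).
by apply/seteqP; split => t /=; rewrite /A /=; have [-> ->] := Ql (z t).
Qed.

Lemma isotropic_halfspace_neq0 (R : realType) (n : nat) (d : measure_display)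
    (T : measurableType d) (P : probability T R) (z : T -> 'rV[R]_n.+1) (r : R)
    (l : 'rV[R]_n.+1) : isotropic P z -> l != 0 ->
  P [set t | enorm (z t) < r /\ enorm l ^+ 2 <= 2 * dotrv (z t) l] =
  P [set t | enorm (z t) < r /\ enorm l <= 2 * z t ord0 ord0].
Proof.
move=> iso l0; rewrite isotropic_halfspace //; congr (P _).
apply/seteqP; split => t /=.
  by rewrite mulrCA expr2 ler_pM2l // enorm_gt0.
by rewrite mulrCA expr2 ler_pM2l // enorm_gt0.
Qed.

(** At [l = 0] the left event still asks for [z_0 >= 0] while the right one does not, so only an
    inequality survives. This is the form needed when [l] ranges over all of [R^n]. *)
Lemma isotropic_halfspace_ge (R : realType) (n : nat) (d : measure_display)
    (T : measurableType d) (P : probability T R) (z : T -> 'rV[R]_n.+1) (r : R)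
    (l : 'rV[R]_n.+1) : random_vector z -> isotropic P z ->
  (P [set t | (enorm (z t) < r)%R /\ (enorm l <= 2 * z t ord0 ord0)%R] <=
   P [set t | (enorm (z t) < r)%R /\ (enorm l ^+ 2 <= 2 * dotrv (z t) l)%R])%E.
Proof.
move=> mz iso; rewrite isotropic_halfspace //.
have mz' i := random_vector_coord _ _ _ _ z i mz.
have m1 := measurable_ltr_set _ _ _ _ (cst r) (measurable_enorm _ _ _ _ _ mz') (measurable_cst _).
apply: le_measure; rewrite ?inE.
- apply: measurableI => //; apply: (measurable_ler_set _ _ _ (cst (enorm l))) => //.
  exact: measurable_funM.
- apply: measurableI => //; apply: (measurable_ler_set _ _ _ (cst (enorm l ^+ 2))) => //.
  by apply: measurable_funM => //; exact: measurable_funM.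
- move=> t /= [-> h]; split => //.
  by rewrite mulrCA expr2 ler_wpM2l // enorm_ge0.
Qed.

(** * Exchange of integrals, ball volumes and the moment comparison *)

(** Tonelli for the indicator of [E]. The probability is exchanged in this way with Lebesgue measure
    on [R^n], with the line and with counting measure. *)
Lemma fubini_section (R : realType) (d d' : measure_display)
    (T : measurableType d) (T' : measurableType d')
    (m : {sigma_finite_measure set T -> \bar R})
    (m' : {sigma_finite_measure set T' -> \bar R}) (E : set (T * T')) :
  measurable E ->
  (\int[m]_t m' [set x | E (t, x)] = \int[m']_x m [set t | E (t, x)])%E.
Proof.
move=> mE; have := indic_fubini_tonelli m m' mE.
rewrite indic_fubini_tonelli_FE // indic_fubini_tonelli_GE // => e.
rewrite [LHS](_ : _ = \int[m]_x (m' \o xsection E) x)%E; last first.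
  by apply: eq_integral => t _; rewrite /= xsectionE.
by rewrite e; apply: eq_integral => t _; rewrite /= ysectionE.
Qed.

Definition tuple_row {R : realType} {n : nat} (x : n.-tuple R) : 'rV[R]_n :=
  \row_i tnth x i.

Lemma measurable_tuple_row (R : realType) (n : nat) (i : 'I_n) :
  measurable_fun setT (fun x : n.-tuple R => tuple_row x ord0 i).
Proof.
rewrite (_ : (fun _ => _) = (fun x : n.-tuple R => tnth x i)).
  exact: measurable_tnth.
by apply/funext => x; rewrite mxE.
Qed.

Lemma measurable_tuple_ball (R : realType) (n : nat) (c : 'rV[R]_n) (rho : R) :
  measurable [set x : n.-tuple R | enorm (tuple_row x - c) <= rho].
Proof.
apply: (measurable_ler_set _ _ _ _ (cst rho)) => //; apply: measurable_enorm => i.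
rewrite (_ : (fun _ => _) = (fun x : n.-tuple R => tuple_row x ord0 i - c ord0 i)).
  by apply: measurable_funB => //; exact: measurable_tuple_row.
by apply/funext => x; rewrite !mxE.
Qed.

Lemma enormZ (R : realType) (n : nat) (a : R) (x : 'rV[R]_n) :
  0 <= a -> enorm (a *: x) = a * enorm x.
Proof.
move=> a0; rewrite /enorm -[in RHS](ger0_norm a0) -sqrtr_sqr -sqrtrM ?sqr_ge0 //.
by congr Num.sqrt; rewrite mulr_sumr; apply: eq_bigr => i _; rewrite mxE exprMn.
Qed.

(** Every ball of positive radius is an affine preimage of the unit ball, so scaling gives the power
    of [rho]. The value of [k], the volume of the unit ball, is irrelevant because it later cancels;
    what matters is that it is positive and finite. *)
Lemma tuple_ball_measure (R : realType) (n : nat) :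
  exists (mu : {sigma_finite_measure set (n.+1.-tuple R) -> \bar R}) (k : R),
    0 < k /\ forall c rho, 0 <= rho ->
      mu [set x | enorm (tuple_row x - c) <= rho] = (k * rho ^+ n.+1)%:E.
Proof.
have [mu [mu_aff mu_cube]] := tuple_lebesgue_measure R n.+1.
pose U : set (n.+1.-tuple R) := [set x | enorm (tuple_row x - 0) <= 1].
have mU : measurable U by exact: measurable_tuple_ball.
have U_fin : (mu U <= (2 ^+ n.+1)%:E)%E.
  have -> : 2 = 1 - (- 1) :> R by rewrite opprK.
  rewrite -mu_cube //; apply: le_measure; rewrite ?inE //; first exact: measurable_tuple_cube.
  move=> x /= Ux i; rewrite -ler_norml; apply: le_trans Ux.
  by have := normr_le_enorm _ _ (tuple_row x - 0) i; rewrite !mxE subr0.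
(* On the cube with side [1 / (n + 1)] each [x_i^2] is at most [x_i], hence at most [1 / (n + 1)],
   so the squares sum to at most 1. *)
have U_pos : ((n.+1%:R^-1 ^+ n.+1)%:E <= mu U)%E.
  rewrite -[X in X ^+ _]subr0 -mu_cube ?invr_ge0 //.
  apply: le_measure; rewrite ?inE //; first exact: measurable_tuple_cube.
  move=> x /= xc; rewrite /U /= subr0 -(@ler_pXn2r _ 2) ?nnegrE ?enorm_ge0 //.
  rewrite sqr_enorm expr1n.
  apply: (@le_trans _ _ (\sum_(i < n.+1) n.+1%:R^-1)); last first.
    by rewrite sumr_const card_ord -[X in X <= _]mulr_natr mulVf.
  apply: ler_sum => i _; rewrite mxE; have /andP[x0 x1] := xc i.
  apply: le_trans (_ : tnth x i * 1 <= _); last by rewrite mulr1.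
  by rewrite ler_wpM2l // (le_trans x1) // invf_le1 // ler1n.
have Uk : mu U = (fine (mu U))%:E.
  by rewrite fineK // ge0_fin_numE // (le_lt_trans U_fin) ?ltry.
have scale s c rho : 0 < s -> mu [set x | enorm (tuple_row x - c) <= rho] =
    ((s^-1 ^+ n.+1)%:E * mu [set x | (enorm (tuple_row x - 0) <= s * rho)%R])%E.
  move=> s0; rewrite -(mu_aff _ [tuple - (s * c ord0 i) | i < n.+1]) //.
    congr (mu _); apply/seteqP; split => x; rewrite /preimage /=.
      rewrite (_ : tuple_row _ - 0 = s *: (tuple_row x - c)).
        by rewrite enormZ ?ler_pM2l // ltW.
      by apply/rowP => i; rewrite !mxE !tnth_mktuple; ring.
    rewrite (_ : tuple_row _ - 0 = s *: (tuple_row x - c)).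
      by rewrite enormZ ?ler_pM2l // ltW.
    by apply/rowP => i; rewrite !mxE !tnth_mktuple; ring.
  exact: measurable_tuple_ball.
exists mu, (fine (mu U)); split.
  by rewrite -lte_fin -Uk (lt_le_trans _ U_pos) // lte_fin exprn_gt0 // invr_gt0.
(* Scaling by [rho^-1] is impossible at [rho = 0]; there the recentred ball lies in a degenerate
   cube of measure 0. *)
move=> c rho; rewrite le_eqVlt => /predU1P[<-|rho0].
  rewrite expr0n mulr0 (scale 1) // invr1 expr1n mul1e mulr0.
  apply/eqP; rewrite eq_le measure_ge0 andbT.
  have := mu_cube _ _ (lexx (0 : R)); rewrite subrr expr0n /= => <-.
  apply: le_measure; rewrite ?inE; [exact: measurable_tuple_ball|exact: measurable_tuple_cube|].
  move=> x /= x0 i; rewrite -[in X in X <= _]oppr0 -ler_norml; apply: le_trans x0.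
  by have := normr_le_enorm _ _ (tuple_row x - 0) i; rewrite !mxE subr0.
by rewrite (scale rho^-1) ?invr_gt0 // invrK mulVf ?gt_eqF // -/U Uk -EFinM mulrC.
Qed.

(* Integrating the two descriptions of the same half-space event against
   Lebesgue measure compares the ball of centre [z] and radius [|z|], of volume
   [k |z|^n], with the centred ball of radius [2 z_0]. *)
Lemma isotropic_moment (R : realType) (n : nat) (d : measure_display)
    (T : measurableType d) (P : probability T R) (z : T -> 'rV[R]_n.+1) (r : R) :
  random_vector z -> isotropic P z ->
  (\int[P]_(t in [set t | (enorm (z t) < r)%R /\ (0 <= z t ord0 ord0)%R])
      ((2 * z t ord0 ord0) ^+ n.+1)%:E <=
   \int[P]_(t in [set t | (enorm (z t) < r)%R]) (enorm (z t) ^+ n.+1)%:E)%E.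
Proof.
move=> mz iso; have [mu [k [k0 mu_ball]]] := tuple_ball_measure R n.
have mz' i := random_vector_coord _ _ _ _ z i mz.
have menz := measurable_enorm _ _ _ _ _ mz'.
have m1 := measurable_ltr_set _ _ _ _ (cst r) menz (measurable_cst _).
have m2 : measurable [set t | enorm (z t) < r /\ 0 <= z t ord0 ord0].
  by apply: measurableI => //; exact: (measurable_ler_set _ _ _ (cst 0)).
have mrow i : measurable_fun setT (fun p : T * n.+1.-tuple R => tuple_row p.2 ord0 i).
  exact: (measurableT_comp (measurable_tuple_row _ _ i) measurable_snd).
have mzT i : measurable_fun setT (fun p : T * n.+1.-tuple R => z p.1 ord0 i).
  exact: (measurableT_comp (mz' i) measurable_fst).
pose E := [set p : T * n.+1.-tuple R |
  enorm (z p.1) < r /\ enorm (tuple_row p.2) <= 2 * z p.1 ord0 ord0].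
pose F := [set p : T * n.+1.-tuple R |
  enorm (z p.1) < r /\ enorm (tuple_row p.2) ^+ 2 <= 2 * dotrv (z p.1) (tuple_row p.2)].
have m3 : measurable [set p : T * n.+1.-tuple R | enorm (z p.1) < r].
  by apply: (measurable_ltr_set _ _ _ _ (cst r)) => //; exact: measurable_enorm.
have mE : measurable E.
  apply: measurableI => //; apply: measurable_ler_set; first exact: measurable_enorm.
  exact: measurable_funM.
have mF : measurable F.
  apply: measurableI => //; apply: measurable_ler_set.
    by apply: measurable_funX; exact: measurable_enorm.
  by apply: measurable_funM => //; exact: measurable_dotrv.
have mulk (D : set T) (g : T -> R) : measurable D -> measurable_fun setT g ->
    (forall t, D t -> 0 <= g t) ->
    (\int[P]_(t in D) (k * g t)%:E = k%:E * \int[P]_(t in D) (g t)%:E)%E.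
  move=> mD mg g0; under eq_integral do rewrite EFinM.
  rewrite ge0_integralZl //.
  - by apply/measurable_EFinP; exact: measurable_funTS.
  - by rewrite lee_fin ltW.
(* Multiplication by [k > 0] turns both integrands into volumes of balls. *)
rewrite -(@lee_pmul2l _ k%:E) // -!mulk //; first last.
- by move=> t [_ z0]; rewrite exprn_ge0 // mulr_ge0.
- by apply: measurable_funX; exact: measurable_funM.
- by move=> t _; rewrite exprn_ge0 // enorm_ge0.
- exact: measurable_funX.
have -> : (\int[P]_(t in [set t | (enorm (z t) < r)%R]) (k * enorm (z t) ^+ n.+1)%:E =
    \int[P]_t mu [set x | F (t, x)])%E.
  rewrite integral_mkcond; apply: eq_integral => t _; rewrite patchE.
  case: ifPn => [/set_mem /= zr|/negP zr].
    rewrite -(mu_ball (z t)) ?enorm_ge0 //; congr (mu _); apply/seteqP.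
    have e x : (enorm (tuple_row x - z t) <= enorm (z t)) =
        (enorm (tuple_row x) ^+ 2 <= 2 * dotrv (z t) (tuple_row x)).
      by rewrite -enormB_le /enorm; congr (Num.sqrt _ <= _); apply: eq_bigr => i _;
         rewrite !mxE -sqrrN opprB.
    by split => x; rewrite /F /= e => // -[].
  rewrite [X in mu X](_ : _ = set0) ?measure0 //.
  by apply/seteqP; split => x //= -[zr' _]; apply: zr; apply/mem_set.
apply: (@le_trans _ _ (\int[P]_t mu [set x | E (t, x)])%E).
  rewrite integral_mkcond; apply: ge0_le_integral => //.
  - move=> t _; rewrite patchE; case: ifPn => // /set_mem [_ z0].
    by rewrite lee_fin mulr_ge0 ?exprn_ge0 ?mulr_ge0 // ltW.
  - apply/(measurable_restrictT _ m2)/measurable_EFinP/measurable_funTS.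
    by apply: measurable_funM => //; apply: measurable_funX; exact: measurable_funM.
  - rewrite (_ : (fun _ => _) = mu \o xsection E); first exact: measurable_fun_xsection.
    by apply/funext => t; rewrite /= xsectionE.
  - move=> t _; rewrite patchE; case: ifPn => [/set_mem [zr z0]|_]; last exact: measure_ge0.
    rewrite -(mu_ball 0) ?mulr_ge0 // le_eqVlt; apply/orP; left; apply/eqP.
    congr (mu _); apply/seteqP.
    by split => x; rewrite /E /= subr0 => // -[].
(* After the exchange the integrands at [x] are the probabilities of the two half-space events of
   the vector [x], comparable even at [x = 0]. *)
rewrite !fubini_section //; apply: ge0_le_integral => //.
- rewrite (_ : (fun _ => _) = P \o ysection E); first exact: measurable_fun_ysection.
  by apply/funext => t; rewrite /= ysectionE.
- rewrite (_ : (fun _ => _) = P \o ysection F); first exact: measurable_fun_ysection.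
  by apply/funext => t; rewrite /= ysectionE.
- by move=> x _; exact: (isotropic_halfspace_ge _ _ _ _ _ _ r (tuple_row x) mz iso).
Qed.

(** * Integration against the density of the norm *)

(** A layer-cake argument: on [D], [g] is the length of the vertical sections of its subgraph [G].
    Tonelli then reduces the claim to the hypothesis on preimages, applied to the horizontal
    sections of [G]. *)
Lemma integral_density (R : realType) (d : measure_display)
    (T : measurableType d) (m : {sigma_finite_measure set T -> \bar R})
    (N : T -> R) (f g : R -> R) (D : set R) :
  measurable_fun setT N -> measurable_fun setT f -> (forall x, 0 <= f x) ->
  (forall S : set R, measurable S ->
     m (N @^-1` S) = (\int[lebesgue_measure]_(x in S) (f x)%:E)%E) ->
  measurable D -> measurable_fun setT g -> (forall x, D x -> 0 <= g x) ->
  (\int[m]_(t in N @^-1` D) (g (N t))%:E =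
   \int[lebesgue_measure]_(x in D) (f x * g x)%:E)%E.
Proof.
move=> mN mf f0 mNf mD mg g0.
pose G := [set p : R * R | D p.1 /\ 0 < p.2 /\ p.2 <= g p.1].
have mG : measurable G.
  apply: measurableI; first by rewrite -[X in measurable X]setTI; exact: measurable_fst.
  apply: measurableI; first exact: (measurable_ltr_set _ _ _ (cst 0)).
  apply: measurable_ler_set => //.
  exact: (measurableT_comp mg measurable_fst).
have lebG x : (lebesgue_measure [set u | G (x, u)] = if x \in D then (g x)%:E else 0)%E.
  case: ifPn => [/set_mem Dx|/negP Dx].
    rewrite (_ : [set u | _] = `]0, g x]%classic).
      rewrite lebesgue_measure_itv /= lte_fin sube0.
      by case: ltP => // gx; congr EFin; apply/le_anti; rewrite gx g0.
    by apply/seteqP; split => u; rewrite /G /= in_itv /=; [move=> [_ [-> ->]]|move=> /andP[]].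
  rewrite (_ : [set u | _] = set0) ?measure0 //.
  by apply/seteqP; split => u //= -[Dx' _]; apply: Dx; apply/mem_set.
have mGu u : measurable [set x | G (x, u)].
  by rewrite -[X in measurable X](ysectionE G); exact: measurable_ysection.
pose E := [set p : T * R | G (N p.1, p.2)].
have mE : measurable E.
  rewrite -[X in measurable X]setTI.
  apply: (_ : measurable_fun setT (fun p : T * R => (N p.1, p.2))) => //.
  by apply: measurable_fun_pair => //; exact: (measurableT_comp mN measurable_fst).
transitivity (\int[m]_t (lebesgue_measure [set u | E (t, u)]))%E.
  rewrite integral_mkcond; apply: eq_integral => t _.
  by rewrite [RHS](lebG (N t)) patchE.
rewrite (@fubini_section _ _ _ _ (measurableTypeR R)) //.
transitivity (\int[lebesgue_measure]_u \int[lebesgue_measure]_x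
    ((f x)%:E * (\1_G (x, u))%:E))%E.
  apply: eq_integral => u _; rewrite [LHS](mNf _ (mGu u)) integral_mkcond.
  apply: eq_integral => x _; rewrite patchE indicE.
  rewrite (_ : (x \in [set x0 | G (x0, u)]) = ((x, u) \in G)).
    by case: ifPn => _; rewrite ?mule1 ?mule0.
  by apply/idP/idP => /set_mem h; apply/mem_set.
(* A second exchange, now with the weight [f x], integrates the layer variable first and recovers
   [g x]. *)
transitivity (\int[lebesgue_measure]_x \int[lebesgue_measure]_u
    ((f x)%:E * (\1_G (x, u))%:E))%E.
  apply/esym; apply: (@fubini_tonelli _ _ (measurableTypeR R) (measurableTypeR R) _
    lebesgue_measure lebesgue_measure (fun p : R * R => (f p.1)%:E * (\1_G p)%:E)%E).
    apply: emeasurable_funM; last by apply/measurable_EFinP; exact: measurable_indic.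
    by apply/measurable_EFinP; exact: (measurableT_comp mf measurable_fst).
  by move=> p; rewrite mule_ge0 // lee_fin.
rewrite [RHS]integral_mkcond; apply: eq_integral => x _.
have mGx : measurable [set u | G (x, u)].
  by rewrite -[X in measurable X](xsectionE G); exact: measurable_xsection.
have GE : (fun u => (\1_G (x, u))%:E) = (fun u => (\1_[set u | G (x, u)] u)%:E : \bar R).
  by apply/funext => u; rewrite !indicE; congr ((_ : bool)%:R%:E).
rewrite ge0_integralZl //; last 2 first.
- by rewrite GE; apply/measurable_EFinP; exact: measurable_indic.
- by rewrite lee_fin.
rewrite patchE GE integral_indic // setIT.
by rewrite [X in (_ * X)%E]lebG; case: ifPn => _; rewrite ?mule0 // EFinM.
Qed.

(** * The union bound over lattice vectors *)

Lemma countable_lattice (R : realType) (n : nat) (B : 'M[R]_n) :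
  countable (lattice B).
Proof.
apply: (@sub_countable _ _ _ ((fun v : 'rV[int]_n => map_mx intr v *m B) @` setT)).
  apply: subset_card_le => _ [v vint <-].
  exists (\row_i Num.floor (v ord0 i)) => //; congr (_ *m _).
  by apply/rowP => i; rewrite !mxE; exact: floorK.
exact: sub_countable (card_image_le _ _) (countableP _).
Qed.

Lemma counting_esum (R : realType) (A : set nat) :
  (@counting _ R A = \esum_(k in A) 1)%E.
Proof.
rewrite counting_dirac nneseries_esumT //.
by rewrite [RHS]esum_mkcond; apply: eq_esum => k _; rewrite diracE; case: ifP.
Qed.

Lemma measurable_voronoi0C (R : realType) (n : nat) (B : 'M[R]_n)
    (d : measure_display) (T : measurableType d) (z : T -> 'rV[R]_n) :
  random_vector z -> measurable (z @^-1` (~` voronoi0 B)).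
Proof.
move=> mz; have mz' i := random_vector_coord _ _ _ _ z i mz.
pose l (v : 'rV[int]_n) : 'rV[R]_n := map_mx intr v *m B.
rewrite (_ : z @^-1` _ = \bigcup_v [set t | l v != 0 /\
    enorm (l v) ^+ 2 <= 2 * dotrv (z t) (l v)]).
  apply: countable_bigcupT_measurable => // v; have [->|v0] := eqVneq (l v) 0.
    by rewrite (_ : [set t | _] = set0) //; apply/seteqP; split => t // -[].
  apply: measurableI; first by rewrite (_ : (fun=> _) = setT) //; apply/seteqP.
  apply: (measurable_ler_set _ _ _ (cst (enorm (l v) ^+ 2))) => //.
  by apply: measurable_funM => //; exact: measurable_dotrv.
apply/seteqP; split => t /=.
  rewrite /voronoi0 /= => /existsNP[_ /not_implyP[[w wint <-]]].
  move=> /not_implyP[w0 /negP]; rewrite -leNgt enormB_le => h.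
  exists (\row_i Num.floor (w ord0 i)) => //=.
  rewrite (_ : l _ = w *m B) //; congr (_ *m _).
  by apply/rowP => i; rewrite !mxE; exact: floorK.
move=> [v _ [v0]]; rewrite -enormB_le leNgt => /negP h V; apply: h; apply: V => //.
exists (map_mx intr v) => // i; rewrite mxE; exact: intr_int.
Qed.

(* The probability of each half-space event depends only on the norm of the
   lattice vector, so the union bound becomes the expected number of nonzero
   lattice vectors in the ball of radius [2 z_0]. *)
Lemma voronoi_union_bound (R : realType) (n : nat) (B : 'M[R]_n.+1)
    (d : measure_display) (T : measurableType d) (P : probability T R)
    (z : T -> 'rV[R]_n.+1) (r K : R) :
  random_vector z -> isotropic P z -> 0 <= K ->
  (forall t, 0 < t -> t <= edelta B * (2 * r) ->
     (count_upto B t <= (K * t ^+ n.+1)%:E)%E) ->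
  (P (z @^-1` (~` voronoi0 B)) <=
   \int[P]_(t in [set t | (enorm (z t) < r)%R /\ (0 <= z t ord0 ord0)%R])
      (K * (edelta B * (2 * z t ord0 ord0)) ^+ n.+1)%:E +
   P [set t | (r <= enorm (z t))%R])%E.
Proof.
move=> mz iso K0 count_le.
have mz' i := random_vector_coord _ _ _ _ z i mz.
have menz := measurable_enorm _ _ _ _ _ mz'.
have m1 := measurable_ltr_set _ _ _ _ (cst r) menz (measurable_cst _).
have m2 : measurable [set t | enorm (z t) < r /\ 0 <= z t ord0 ord0].
  by apply: measurableI => //; exact: (measurable_ler_set _ _ _ (cst 0)).
have m3 : measurable [set t | r <= enorm (z t)].
  exact: (measurable_ler_set _ _ _ (cst r)).
have ed0 : 0 < edelta B by exact: expR_gt0.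
pose L0 := [set l | lattice B l /\ l != 0].
(* The enumeration is bijective so that each nonzero lattice vector is counted once, as in
   [count_upto]. *)
have [J [e [eJ einj esurj]]] : exists (J : set nat) (e : nat -> 'rV[R]_n.+1), set_bij J L0 e.
  have : countable L0.
    by apply: sub_countable (countable_lattice _ _ B); apply: subset_card_le => l [].
  move=> /countable_bijP[J]; rewrite card_eq_sym => /card_set_bijP[e he].
  by exists J, e.
have e_neq0 k : J k -> e k != 0 by move=> Jk; have [] := eJ k Jk.
pose G k := [set t | J k /\ enorm (e k) ^+ 2 <= 2 * dotrv (z t) (e k)].
pose H k := [set t | enorm (z t) < r /\ G k t].
have mJ k : measurable [set _ : T | J k].
  by have [Jk|Jk] := pselect (J k);
    [rewrite (_ : [set _ | _] = setT)|rewrite (_ : [set _ | _] = set0)] => //;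
    apply/seteqP; split.
have mG k : measurable (G k).
  apply: measurableI; first exact: mJ.
  apply: (measurable_ler_set _ _ _ (cst (enorm (e k) ^+ 2))) => //.
  by apply: measurable_funM => //; exact: measurable_dotrv.
have mH k : measurable (H k) by exact: measurableI.
have VG : z @^-1` (~` voronoi0 B) = \bigcup_k G k.
  apply/seteqP; split => t /=.
    rewrite /voronoi0 /= => /existsNP[l /not_implyP[ll /not_implyP[l0 /negP]]].
    rewrite -leNgt enormB_le => h.
    by have [k Jk ek] := esurj l (conj ll l0); exists k => //; rewrite /G /= ek.
  move=> [k _ [Jk]]; rewrite -enormB_le leNgt => /negP h V; apply: h; apply: V.
    by have [] := eJ k Jk.
  exact: e_neq0.
have mV : measurable (z @^-1` (~` voronoi0 B)) by exact: measurable_voronoi0C.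
have mHU : measurable (\bigcup_k H k) by exact: bigcupT_measurable.
apply: (@le_trans _ _ (P (\bigcup_k H k) + P [set t | (r <= enorm (z t))%R])%E).
  apply: le_trans (measureU2 P mHU m3); apply: le_measure; rewrite ?inE //.
    exact: measurableU.
  rewrite VG => t [k _ Gk]; have [rz|zr] := leP r (enorm (z t)); first by right.
  by left; exists k.
rewrite leeD2r //.
apply: (le_trans (measure_sigma_subadditive P mH mHU (@subset_refl _ _))).
(* Reading the sum as an integral for counting measure lets [fubini_section] turn it into an
   expected number of lattice vectors. *)
rewrite -ge0_integral_count //.
pose E := [set p : T * nat | J p.2 /\ enorm (z p.1) < r /\
  enorm (e p.2) <= 2 * z p.1 ord0 ord0].
have mzT i : measurable_fun setT (fun p : T * nat => z p.1 ord0 i).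
  exact: (measurableT_comp (mz' i) measurable_fst).
have mE : measurable E.
  apply: measurableI.
    by rewrite -[X in measurable X]setTI; apply: measurable_snd.
  apply: measurableI.
    by apply: (measurable_ltr_set _ _ _ _ (cst r)) => //; exact: measurable_enorm.
  apply: measurable_ler_set; last exact: measurable_funM.
  apply: (@measurableT_comp _ _ _ _ _ _ (fun k => enorm (e k))) => //.
have -> : (\int[counting]_k P (H k) = \int[counting]_k P [set t | E (t, k)])%E.
  apply: eq_integral => k _; have [Jk|Jk] := pselect (J k).
    rewrite (_ : H k = [set t | enorm (z t) < r /\
        enorm (e k) ^+ 2 <= 2 * dotrv (z t) (e k)]).
      rewrite isotropic_halfspace_neq0 //; last exact: e_neq0.
      by congr (P _); apply/seteqP; split => t [] // _ [].
    by apply/seteqP; split => t [zr] // [].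
  by congr (P _); apply/seteqP; split => t; [case=> _ []|case].
have [cnt cntE] := exists_sigma_finite_measure _ _ _ _ (sigma_finite_counting R).
rewrite [leLHS](_ : _ = \int[P]_t cnt [set k | E (t, k)])%E; last first.
  by rewrite (fubini_section _ _ _ _ _ P cnt E mE) cntE.
rewrite [leRHS]integral_mkcond.
apply: ge0_le_integral => //.
- rewrite (_ : (fun _ => _) = cnt \o xsection E); first exact: measurable_fun_xsection.
  by apply/funext => t; rewrite /= xsectionE.
- apply/(measurable_restrictT _ m2)/measurable_EFinP/measurable_funTS.
  by apply: measurable_funM => //; apply: measurable_funX; do 2 apply: measurable_funM => //.
move=> t _; rewrite patchE.
(* The counting hypothesis covers positive radii only; for [z_0 <= 0] no nonzero vector has norm at
   most [2 z_0]. *)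
have [z0|z0] := ltP 0 (z t ord0 ord0); last first.
  rewrite (_ : [set k | _] = set0) ?measure0.
    case: ifPn => // /set_mem [_ z0']; rewrite lee_fin.
    by rewrite mulr_ge0 ?exprn_ge0 // mulr_ge0 ?(ltW ed0) // mulr_ge0.
  apply/seteqP; split => // k [/= Jk [_ ez]].
  have := lt_le_trans (enorm_gt0 _ _ _ (e_neq0 k Jk)) ez.
  by rewrite pmulr_rgt0 // ltNge z0.
have [zr|zr] := ltP (enorm (z t)) r; last first.
  rewrite memNset; last by move=> -[/=]; rewrite ltNge zr.
  rewrite (_ : [set k | _] = set0) ?measure0 //.
  by apply/seteqP; split => // k [/= Jk []]; rewrite ltNge zr.
rewrite mem_set; last by split => //; exact: ltW.
(* The hypothesis is used at [edelta B * (2 * z_0)], which is in range because [z_0 <= |z| < r]. *)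
apply: le_trans (count_le _ _ _); last 2 first.
- by rewrite !mulr_gt0.
- rewrite ler_pM2l // ler_pM2l // (le_trans (ler_norm _)) //.
  exact: le_trans (normr_le_enorm _ _ _ _) (ltW zr).
rewrite cntE [leLHS]counting_esum /count_upto le_eqVlt; apply/orP; left; apply/eqP/esym.
apply: (@reindex_esum _ _ _ _ _ e); split.
- move=> k [Jk [_ /= ek]]; have [? ?] := eJ k Jk.
  by split => //; split => //; rewrite ler_pM2l.
- move=> k k' /set_mem[Jk _] /set_mem[Jk' _]; apply: einj; exact/mem_set.
- move=> l [ll [l0]]; rewrite /= ler_pM2l // => ln.
  by have [k Jk ek] := esurj l (conj ll l0); exists k => //; rewrite /E /= ek.
Qed.

(** * From admissible functions to the radial bound *)

Lemma unit_ball_vol_gt0 (R : realType) (n : nat) : 0 < unit_ball_vol n :> R.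
Proof.
suff : 0 < unit_ball_vol n :> R /\ 0 < unit_ball_vol n.+1 :> R by case.
elim: n => [|n [IH1 IH2]]; first by split; rewrite /= ?ltr01 ?ltr0n.
by split => //; rewrite /= mulr_gt0 // divr_gt0 // mulr_gt0 // pi_gt0.
Qed.

Lemma integral_exprn (R : realType) (n : nat) (t : R) : 0 < t ->
  (\int[lebesgue_measure]_(x in `[0%R, t]) (n.+1%:R * x ^+ n)%:E = (t ^+ n.+1)%:E)%E.
Proof.
move=> t0; rewrite (@continuous_FTC2 _ _ (fun x => x ^+ n.+1)) //.
- by rewrite expr0n sube0.
- apply: continuous_subspaceT => x; apply: cvgM; first exact: cvg_cst.
  exact: exprn_continuous.
- split.
  + by move=> x _; exact: exprn_derivable.
  + by apply: cvg_at_right_filter; exact: exprn_continuous.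
  + by apply: cvg_at_left_filter; exact: exprn_continuous.
- by move=> x _; rewrite exp_derive1.
Qed.

(** The bound on [alpha_prime] says [N' x <= A n V_n x^(n-1)] in dimension [n], and the right-hand
    side integrates to [A V_n t^n]. *)
Lemma count_upto_le (R : realType) (n : nat) (B : 'M[R]_n.+1) (r A : R)
    (N' : R -> R) :
  admissible_Nprime B (2 * r) N' ->
  (forall x, 0 < x -> x <= 2 * edelta B * r -> alpha_prime n.+1 N' x <= A) ->
  forall t, 0 < t -> t <= edelta B * (2 * r) ->
    (count_upto B t <= (A * unit_ball_vol n.+1 * t ^+ n.+1)%:E)%E.
Proof.
move=> [mN N0 _ cN] NA t t0 tr; apply: (le_trans (cN t t0 tr)).
have V0 := unit_ball_vol_gt0 R n.+1.
have tr' : t <= 2 * edelta B * r by rewrite (le_trans tr) // mulrCA mulrA.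
have A0 : 0 <= A.
  apply: le_trans (NA t t0 tr'); rewrite /alpha_prime divr_ge0 ?N0 //.
  by rewrite mulr_ge0 ?exprn_ge0 ?(ltW t0) // mulr_ge0 // ltW.
have AV0 : 0 <= A * unit_ball_vol n.+1 by rewrite mulr_ge0 // ltW.
have mg (D : set R) : measurable_fun D (fun x : R => (n.+1%:R * x ^+ n)%:E).
  by apply/measurable_EFinP/measurable_funTS; apply: measurable_funM => //; exact: measurable_funX.
apply: (@le_trans _ _ (\int[lebesgue_measure]_(x in `]0%R, t])
    ((A * unit_ball_vol n.+1)%:E * (n.+1%:R * x ^+ n)%:E))%E).
  apply: ge0_le_integral => //.
  - by move=> x /=; rewrite in_itv /= => /andP[x0 _]; rewrite lee_fin N0.
  - apply/measurable_EFinP; apply: measurable_funS mN => //.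
    by move=> x /=; rewrite !in_itv /= andbT => /andP[].
  - by apply: emeasurable_funM => //; exact: mg.
  - move=> x /=; rewrite in_itv /= => /andP[x0 xt].
    rewrite -EFinM lee_fin; have := NA x x0 (le_trans xt tr').
    rewrite /alpha_prime ler_pdivrMr; last by rewrite mulr_gt0 ?exprn_gt0 // mulr_gt0.
    by move/le_trans; apply; rewrite /= -!mulrA (mulrCA n.+1%:R).
rewrite ge0_integralZl //; first last.
- move=> x /=; rewrite in_itv /= => /andP[x0 _].
  by rewrite lee_fin mulr_ge0 // exprn_ge0 // ltW.
- exact: mg.
rewrite [leRHS]EFinM lee_wpmul2l // -integral_exprn //.
apply: ge0_subset_integral => //.
- exact: mg.
- by move=> x /=; rewrite in_itv /= => /andP[x0 _]; rewrite lee_fin mulr_ge0 // exprn_ge0.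
- by move=> x /=; rewrite !in_itv /= => /andP[/ltW -> ->].
Qed.

(** Through this identity the rescaling of norms by [e^delta] becomes the factor [beta] of the final
    bound. *)
Lemma edeltaX (R : realType) (n : nat) (B : 'M[R]_n.+1) :
  \det B != 0 -> edelta B ^+ n.+1 = lat_beta B.
Proof.
move=> B0; rewrite /edelta -expRM_natl /lat_delta mulrC divfK //.
by rewrite lnK // posrE invr_gt0 normr_gt0.
Qed.

(** The estimate for one admissible [N'] and a finite upper bound [A] of [alpha_prime], before any
    supremum or infimum is taken. *)
Lemma voronoi_radial_bound (R : realType) (n : nat) (B : 'M[R]_n.+1)
    (d : measure_display) (T : measurableType d) (P : probability T R)
    (z : T -> 'rV[R]_n.+1) (f : R -> R) (r A : R) (N' : R -> R) :
  \det B != 0 -> random_vector z -> isotropic P z ->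
  measurable_fun setT f -> (forall x, 0 <= f x) ->
  (forall S : set R, measurable S ->
     P ((fun t => enorm (z t)) @^-1` S) =
       (\int[lebesgue_measure]_(x in S) (f x)%:E)%E) ->
  0 < r -> admissible_Nprime B (2 * r) N' ->
  (forall x, 0 < x -> x <= 2 * edelta B * r -> alpha_prime n.+1 N' x <= A) ->
  (P (z @^-1` (~` voronoi0 B)) <=
   A%:E * ((lat_beta B * unit_ball_vol n.+1)%:E *
      \int[lebesgue_measure]_(x in `[0%R, r]) (f x * x ^+ n.+1)%:E)
   + \int[lebesgue_measure]_(x in `[r, +oo[) (f x)%:E)%E.
Proof.
move=> B0 mz iso mf f0 Pf r0 adm NA.
have mz' i := random_vector_coord _ _ _ _ z i mz.
have menz := measurable_enorm _ _ _ _ _ mz'.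
have V0 := unit_ball_vol_gt0 R n.+1.
have ed0 : 0 < edelta B by exact: expR_gt0.
have A0 : 0 <= A.
  have e0 : 0 < 2 * edelta B * r by rewrite !mulr_gt0.
  apply: le_trans (NA _ e0 (lexx _)); rewrite /alpha_prime divr_ge0 //.
    by have [_ N0 _ _] := adm; exact: N0.
  by rewrite mulr_ge0 ?exprn_ge0 ?(ltW e0) // mulr_ge0 // ltW.
have AV0 : 0 <= A * unit_ball_vol n.+1 by rewrite mulr_ge0 // ltW.
apply: (le_trans (voronoi_union_bound _ _ _ _ _ _ _ _ _ mz iso AV0
  (count_upto_le _ _ _ _ _ _ adm NA))).
apply: leeD; last first.
  rewrite -Pf // (_ : [set t | _] = (fun t => enorm (z t)) @^-1` `[r, +oo[) //.
  by apply/seteqP; split => t; rewrite /= in_itv /= andbT.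
have m1 := measurable_ltr_set _ _ _ _ (cst r) menz (measurable_cst _).
have m2 : measurable [set t | enorm (z t) < r /\ 0 <= z t ord0 ord0].
  by apply: measurableI => //; exact: (measurable_ler_set _ _ _ (cst 0)).
rewrite (eq_integral (fun t => (A * (lat_beta B * unit_ball_vol n.+1))%:E *
    ((2 * z t ord0 ord0) ^+ n.+1)%:E)%E); last first.
  by move=> t _; rewrite -EFinM exprMn edeltaX //; congr EFin; ring.
have AbV0 : 0 <= A * (lat_beta B * unit_ball_vol n.+1).
  by rewrite mulr_ge0 // mulr_ge0 // ?invr_ge0 // ltW.
rewrite ge0_integralZl //; first last.
- by move=> t [_ z0]; rewrite lee_fin exprn_ge0 // mulr_ge0.
- apply/measurable_EFinP/measurable_funTS; apply: measurable_funX; exact: measurable_funM.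
rewrite muleA -EFinM lee_wpmul2l //.
apply: (le_trans (isotropic_moment _ _ _ _ _ _ _ mz iso)).
have mX : measurable_fun setT (fun x : R => x ^+ n.+1) by exact: measurable_funX.
rewrite (_ : [set t | _] = (fun t => enorm (z t)) @^-1` `[0, r[); last first.
  by apply/seteqP; split => t; rewrite /= in_itv /= enorm_ge0.
rewrite (integral_density _ _ _ P _ f (fun x => x ^+ n.+1)) //; last first.
  by move=> x /=; rewrite in_itv /= => /andP[x0 _]; rewrite exprn_ge0.
apply: ge0_subset_integral => //.
- by apply/measurable_EFinP/measurable_funTS; exact: measurable_funM.
- by move=> x /=; rewrite in_itv /= => /andP[x0 _]; rewrite lee_fin mulr_ge0 // exprn_ge0.
- by move=> x /=; rewrite !in_itv /= => /andP[-> /ltW ->].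
Qed.

(** * The degenerate case and the passage to the infimum *)

(** The weight [x^n] is positive on []0, r]] and the endpoint 0 is null, so [f] vanishes almost
    everywhere on the interval. *)
Lemma integral_eq0_of_weighted (R : realType) (n : nat) (f : R -> R) (r : R) :
  measurable_fun setT f -> (forall x, 0 <= f x) ->
  (\int[lebesgue_measure]_(x in `[0%R, r]) (f x * x ^+ n)%:E = 0)%E ->
  (\int[lebesgue_measure]_(x in `[0%R, r]) (f x)%:E = 0)%E.
Proof.
move=> mf f0 I0.
have mI : measurable (`]0%R, r] : set R) by [].
have mfX : measurable_fun setT (fun x => (f x * x ^+ n)%:E).
  by apply/measurable_EFinP; apply: measurable_funM => //; exact: measurable_funX.
have mfE : measurable_fun setT (EFin \o f) by exact/measurable_EFinP.
rewrite -integral_itv_obnd_cbnd; last exact: measurable_funTS.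
move: I0; rewrite -integral_itv_obnd_cbnd; last exact: measurable_funTS.
move=> I0.
have : (\int[lebesgue_measure]_(x in `]0%R, r]) `|(f x * x ^+ n)%:E| = 0)%E.
  rewrite -[RHS]I0; apply: eq_integral => x /[!inE] /=; rewrite in_itv /= => /andP[x0 _].
  by rewrite ger0_norm // mulr_ge0 // exprn_ge0 // ltW.
have [ae0 _] := ae_eq_integral_abs (@lebesgue_measure R) mI (measurable_funTS mfX).
move=> /ae0 {}ae0.
rewrite (@ge0_ae_eq_integral _ _ _ _ _ _ (cst 0)%E) //.
- by rewrite integral0.
- exact: measurable_funTS.
- by move=> x _; rewrite lee_fin.
- apply: filterS ae0 => x h xI; move: (h xI) => /eqP; rewrite eqe mulf_eq0.
  move: xI; rewrite /= in_itv /= => /andP[x0 _].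
  by rewrite [X in _ || X]gt_eqF ?exprn_gt0 // orbF => /eqP ->.
Qed.

Theorem theorem5 (R : realType) (n : nat) (B : 'M[R]_n)
    (d : measure_display) (T : measurableType d) (P : probability T R)
    (z : T -> 'rV[R]_n) (f : R -> R) :
  (0 < n)%N ->
  \det B != 0 ->
  (* z is a random vector (Borel measurable) *)
  (forall A : set 'rV[R]_n, <<s @open 'rV[R]_n >> A -> measurable (z @^-1` A)) ->
  (* isotropy: the law of z is invariant under orthogonal maps *)
  (forall Q : 'M[R]_n, Q *m Q^T = 1%:M ->
     forall A : set 'rV[R]_n, <<s @open 'rV[R]_n >> A ->
       P (z @^-1` A) = P ((fun t => z t *m Q) @^-1` A)) ->
  (* f is a density of ||z|| *)
  measurable_fun setT f ->
  (forall x, 0 <= f x) ->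
  (forall S : set R, measurable S ->
     P ((fun t => enorm (z t)) @^-1` S) =
       (\int[lebesgue_measure]_(x in S) (f x)%:E)%E) ->
  (* the density of z is a non-increasing function of ||z||:
     rho |-> f(rho) / rho^(n-1) is non-increasing on (0, +oo) *)
  (forall x y, 0 < x -> x <= y -> f y / y ^+ n.-1 <= f x / x ^+ n.-1) ->
  (forall r, 0 < r -> (P (z @^-1` (~` voronoi0 B)) <= pe_bound B f r)%E) /\
  (P (z @^-1` (~` voronoi0 B)) <= ereal_inf [set pe_bound B f r | r in (`]0%R, +oo[ : set R)])%E.
Proof.
case: n => // n in B z *; move=> _ B0 mz iso mf f0 Pf _.
suff main r : 0 < r -> (P (z @^-1` (~` voronoi0 B)) <= pe_bound B f r)%E.
  split => //; apply/ereal_infP => _ [r r0 <-]; apply: main.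
  by move: r0; rewrite /= in_itv /= andbT.
move=> r0; rewrite /pe_bound.
have mV := measurable_voronoi0C _ _ B _ _ z mz.
have menz := measurable_enorm _ _ _ _ _ (fun i => random_vector_coord _ _ _ _ z i mz).
have mpre (S : set R) : measurable S -> measurable ((fun t => enorm (z t)) @^-1` S).
  by move=> mS; rewrite -[X in measurable X]setTI; exact: menz.
set tail := (\int[lebesgue_measure]_(x in `[r, +oo[) _)%E.
set I := (\int[lebesgue_measure]_(x in `[0%R, r]) _)%E.
have tailE : tail = P ((fun t => enorm (z t)) @^-1` `[r, +oo[) by rewrite Pf.
have tail_fin : tail \is a fin_num by rewrite tailE fin_num_measure //; exact: mpre.
have I0 : (0 <= I)%E.
  apply: integral_ge0 => x /=; rewrite in_itv /= => /andP[x0 _].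
  by rewrite lee_fin mulr_ge0 // exprn_ge0.
have mX : measurable_fun setT (fun x : R => x ^+ n.+1) by exact: measurable_funX.
have I_fin : I \is a fin_num.
  rewrite ge0_fin_numE //.
  apply: (@le_lt_trans _ _ (\int[lebesgue_measure]_(x in `[0%R, r]) ((r ^+ n.+1)%:E * (f x)%:E))%E).
    apply: ge0_le_integral => //.
    - move=> x /=; rewrite in_itv /= => /andP[x0 _].
      by rewrite lee_fin mulr_ge0 // exprn_ge0.
    - by apply/measurable_EFinP/measurable_funTS; exact: measurable_funM.
    - by apply: emeasurable_funM => //; apply/measurable_EFinP/measurable_funTS.
    - move=> x /=; rewrite in_itv /= => /andP[x0 xr].
      by rewrite -EFinM lee_fin mulrC ler_wpM2r // lerXn2r // nnegrE // ltW.
  rewrite ge0_integralZl //.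
  - rewrite -Pf // lte_mul_pinfty ?lee_fin ?exprn_ge0 ?(ltW r0) //.
    by rewrite (le_lt_trans (probability_le1 _ _)) ?ltry //; exact: mpre.
  - exact/measurable_EFinP/measurable_funTS.
  - by move=> x _; rewrite lee_fin.
  - by rewrite lee_fin exprn_ge0 // ltW.
have bV0 : 0 < lat_beta B * unit_ball_vol n.+1.
  by rewrite mulr_gt0 ?unit_ball_vol_gt0 // invr_gt0 normr_gt0.
(* If [I = 0], the first term is 0 even when [alpha_r] is infinite, by the convention for [+oo * 0].
   The tail alone must then suffice, and it does because the norm lies in [[0, r]] with probability
   0. *)
have [Iz|Inz] := eqVneq I 0%E.
  rewrite Iz !mule0 add0e.
  apply: (@le_trans _ _ (P ((fun t => enorm (z t)) @^-1` (`[0, r] `|` `[r, +oo[)))).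
    apply: le_measure; rewrite ?inE //; first by apply: mpre; exact: measurableU.
    move=> t _ /=; rewrite !in_itv /= enorm_ge0 andbT.
    by have [|/ltW] := leP (enorm (z t)) r; [left|right].
  rewrite preimage_setU.
  apply: (le_trans (measureU2 P (mpre _ _) (mpre _ _))) => //.
  by rewrite [X in (X + _)%E]Pf // [X in (_ + X)%E]Pf // (integral_eq0_of_weighted _ n.+1) // add0e.
set c := ((lat_beta B * unit_ball_vol n.+1)%:E * I)%E.
have c_fin : c \is a fin_num by rewrite fin_numM.
have c0 : (0 < c)%E by rewrite mule_gt0 // lt0e Inz.
have cr0 : 0 < fine c by rewrite -lte_fin fineK.
(* As [c] is positive and finite, division by it isolates the infimum, which can then be checked one
   [N'] at a time. *)
rewrite -leeBlDr // -(fineK c_fin) -lee_pdivrMr //.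
apply/ereal_infP => _ [N' adm <-].
have sup_ub x : 0 < x -> x <= 2 * edelta B * r ->
    ((alpha_prime n.+1 N' x)%:E <= ereal_sup
      [set (alpha_prime n.+1 N' y)%:E | y in `]0%R, (2 * edelta B * r)%R]])%E.
  by move=> x0 xr; apply: ereal_sup_ubound; exists x => //=; rewrite in_itv /= x0.
have e0 : 0 < 2 * edelta B * r by rewrite !mulr_gt0 // expR_gt0.
(* An infinite supremum makes the claim trivial, and [-oo] is excluded because the interval of [x]
   is nonempty. *)
case: (ereal_sup _) sup_ub => [A| |] sup_ub; last 2 first.
- exact: leey.
- by have := sup_ub _ e0 (lexx _); rewrite leNgt ltNyr.
rewrite lee_pdivrMr // fineK // leeBlDr //.
exact: (voronoi_radial_bound _ _ _ _ _ _ _ _ _ _ N').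
Qed.
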